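(* Let $G=(V,E)$ be a finite simple undirected graph and let $\mathcal{G}$ be a potential game with player set $V$ and potential $\Phi\colon\mathcal{S}\to\mathbb{R}$. Then $\mathcal{G}$ is strategically equivalent to a graphical game on $G$ if and only if there exist functions $\Phi^C\colon\prod_{i\in C}\mathcal{S}_i\to\mathbb{R}$, $C\in\mathcal{C}(G)$, such that for all $a\in\mathcal{S}$ $$\Phi(a)=\sum_{C\in\mathcal{C}(G)}\Phi^C(a^C).$$
   Context: A game has a finite player set $V$ with $|V|=n$; each player $i\in V$ has a finite (nonempty) strategy set $\mathcal{S}_i$; the set of strategy profiles is $\mathcal{S}=\prod_{i\in V}\mathcal{S}_i$; player $i$ has a real-valued utility $u_i\colon\mathcal{S}\to\mathbb{R}$. Fix an arbitrary distinguished strategy $o_i\in\mathcal{S}_i$ for each $i$; for $a\in\mathcal{S}$, $a^i$ denotes the profile obtained from $a$ by replacing $a_i$ with $o_i$. Graphical game on $G$: whenever $i\ne j$ and $(i,j)\notin E$, $u_i(a)=u_i(a^j)$ for all $a\in\mathcal{S}$ (this does not depend on the choice of the $o_i$). Potential game: there is a function $\Phi\colon\mathcal{S}\to\mathbb{R}$ (a potential) with $u_i(a)-u_i(a^i)=\Phi(a)-\Phi(a^i)$ for all $i\in V$, $a\in\mathcal{S}$. Potentials of a given game differ by constants; by convention the potential is normalized so that $\sum_{a\in\mathcal{S}}e^{\Phi(a)}=1$. Strategic equivalence: two games with utilities $u$ and $w$ over the same strategy profile set $\mathcal{S}$ are strategically equivalent if there are functions $f_i\colon\mathcal{S}^{-i}\to\mathbb{R}$,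 $i\in V$, with $u_i(a)=w_i(a)+f_i(a_{-i})$ for all $a\in\mathcal{S}$, where $\mathcal{S}^{-i}=\prod_{j\neq i}\mathcal{S}_j$ and $a_{-i}$ is the restriction of $a$ to $V\setminus\{i\}$. $\mathcal{C}(G)$ is the set of maximal cliques of $G$, i.e. cliques not contained in strictly larger cliques (an isolated vertex is a maximal clique of size one). For $W\subseteq V$, $a^W\in\prod_{i\in W}\mathcal{S}_i$ denotes the restriction of $a$ to $W$. *)

(* Defs.v *)
From mathcomp Require Import all_boot all_order all_algebra.
From mathcomp Require Import reals sequences.

Set Implicit Arguments.
Unset Strict Implicit.
Unset Printing Implicit Defensive.

Import GRing.Theory.
Local Open Scope ring_scope.

Definition profile (V : finType) (S : V -> finType) :=
  {dffun forall i : V, S i}.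

(* For [W = ~: [set i]] this is the set S^{-i} of profiles of the players
   other than [i]. *)
Definition subprofile (V : finType) (S : V -> finType) (W : {set V}) :=
  {dffun forall i : {i : V | i \in W}, S (val i)}.

Definition restrict_profile (V : finType) (S : V -> finType) (W : {set V})
    (a : profile S) : subprofile S W :=
  [ffun i : {i : V | i \in W} => a (val i)].

(* The profile a^i: the strategy of player [i] is reset to [o i]. *)
Definition reset (V : finType) (S : V -> finType) (o : forall i : V, S i)
    (i : V) (a : profile S) : profile S :=
  [ffun j : V => if j == i then o j else a j].

(* A game with strategy sets [S] is given by its utilities. *)
Definition game (R : realType) (V : finType) (S : V -> finType) :=
  V -> profile S -> R.

Definition graphical (R : realType) (V : finType) (S : V -> finType)
    (o : forall i : V, S i) (e : rel V) (u : game R S) : Prop :=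
  forall i j : V, i != j -> ~~ e i j ->
    forall a : profile S, u i a = u i (reset o j a).

Definition potential (R : realType) (V : finType) (S : V -> finType)
    (o : forall i : V, S i) (u : game R S) (Phi : profile S -> R) : Prop :=
  forall (i : V) (a : profile S),
    u i a - u i (reset o i a) = Phi a - Phi (reset o i a).

Definition normalized (R : realType) (V : finType) (S : V -> finType)
    (Phi : profile S -> R) : Prop :=
  \sum_(a : profile S) expR (Phi a) = 1.

Definition strategically_equivalent (R : realType) (V : finType)
    (S : V -> finType) (u w : game R S) : Prop :=
  exists f : forall i : V, subprofile S (~: [set i]) -> R,
    forall (i : V) (a : profile S),
      u i a = w i a + f i (restrict_profile (~: [set i]) a).

Definition clique (V : finType) (e : rel V) (C : {set V}) : bool :=
  [forall x in C, forall y in C, (x != y) ==> e x y].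

(* The empty set counts as a clique; it is maximal only if [V] is empty. *)
Definition maximal_cliques (V : finType) (e : rel V) : {set {set V}} :=
  [set C | maxset (clique e) C].

(* Main.v *)
Require Import Defs.
From mathcomp Require Import all_boot all_order all_algebra.
From mathcomp Require Import reals sequences.

Set Implicit Arguments.
Unset Strict Implicit.
Unset Printing Implicit Defensive.

Import GRing.Theory.
Local Open Scope ring_scope.

(** Strategic equivalence to a graphical game forces the mixed differences
    [Phi a - Phi a^i - Phi a^j + Phi a^{ij}] of non-adjacent players to vanish.
    Write [a_A] for the profile [a] reset outside [A].  If [A] contains
    non-adjacent [i] and [j], the vanishing difference at [a_A] expresses
    [Phi a_A] through the sets [A - i], [A - j] and [A - i - j]; so by induction
    on [A] the function [a |-> Phi a_A] is a sum of functions of clique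
    restrictions, and [A = V] gives the decomposition.  Conversely, the sum of
    the terms [Phi^C] with [i \in C] is a utility for [i] that has the same
    differences in direction [i] as [Phi], and it ignores the players that are
    not adjacent to [i]. *)

Section Profiles.
Variables (V : finType) (S : V -> finType) (o : forall i : V, S i).

Definition reset_outside (W : {set V}) (a : profile S) : profile S :=
  [ffun i : V => if i \in W then a i else o i].

(** Filling in [o i] outside [W] lets a function of full profiles be read as a function of
    subprofiles; the [match] on [boolP] supplies the membership proof that an index of [b]
    carries. *)
Definition extend_profile (W : {set V}) (b : subprofile S W) : profile S :=
  [ffun i : V => match boolP (i \in W) with
                 | AltTrue iW => b (exist _ i iW)
                 | AltFalse _ => o i
                 end].

Lemma extend_restrict (W : {set V}) (a : profile S) :
  extend_profile (restrict_profile W a) = reset_outside W a.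
Proof.
apply/ffunP => i; rewrite !ffunE.
by case: {-}_ / boolP => [iW|iW]; rewrite ?ffunE /= ?iW ?(negbTE iW).
Qed.

Lemma reset_outside_sub (A B : {set V}) (a : profile S) :
  A \subset B -> reset_outside A (reset_outside B a) = reset_outside A a.
Proof.
by move=> /subsetP AB; apply/ffunP => i; rewrite !ffunE; case: ifP => // /AB ->.
Qed.

Lemma reset_outsideT (a : profile S) : reset_outside [set: V] a = a.
Proof. by apply/ffunP => i; rewrite !ffunE inE. Qed.

Lemma reset_outsideD1 (A : {set V}) (i : V) (a : profile S) :
  reset_outside (A :\ i) a = reset o i (reset_outside A a).
Proof.
by apply/ffunP => j; rewrite !ffunE !inE; case: eqVneq => [->|].
Qed.

Lemma reset_outsideC1 (i : V) (a : profile S) :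
  reset_outside (~: [set i]) a = reset o i a.
Proof. by rewrite -setTD reset_outsideD1 reset_outsideT. Qed.

Lemma resetC (i j : V) (a : profile S) :
  reset o i (reset o j a) = reset o j (reset o i a).
Proof.
by apply/ffunP => k; rewrite !ffunE; do 2!case: ifP.
Qed.

Lemma restrict_reset (W : {set V}) (i : V) (a : profile S) :
  i \notin W -> restrict_profile W (reset o i a) = restrict_profile W a.
Proof.
move=> iW; apply/ffunP => -[j jW]; rewrite !ffunE /=.
by case: eqVneq jW => // ->; rewrite (negbTE iW).
Qed.

End Profiles.

Lemma sub_maximal_clique (V : finType) (e : rel V) (A : {set V}) :
  clique e A -> exists2 C, C \in maximal_cliques e & A \subset C.
Proof.
by move=> /maxset_exists[C Cmax AC]; exists C; rewrite ?inE.
Qed.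

Lemma nonclique_nonadjacent (V : finType) (e : rel V) (A : {set V}) :
  ~~ clique e A ->
  exists i j, [/\ i \in A, j \in A, i != j & ~~ e i j].
Proof.
rewrite negb_forall => /existsP[i]; rewrite negb_imply => /andP[iA].
rewrite negb_forall => /existsP[j]; rewrite !negb_imply.
by move=> /and3P[jA ij eij]; exists i, j.
Qed.

Section CliqueSums.
Variables (R : realType) (V : finType) (S : V -> finType).
Variables (o : forall i : V, S i) (e : rel V).

Definition clique_sum (F : profile S -> R) : Prop :=
  exists PhiC : forall C : {set V}, subprofile S C -> R,
    forall a : profile S,
      F a = \sum_(C in maximal_cliques e) PhiC C (restrict_profile C a).

Lemma clique_sumD (F G : profile S -> R) :
  clique_sum F -> clique_sum G -> clique_sum (fun a => F a + G a).
Proof.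
move=> [f Ff] [g Gg]; exists (fun C b => f C b + g C b) => a.
by rewrite Ff Gg big_split.
Qed.

Lemma clique_sumN (F : profile S -> R) :
  clique_sum F -> clique_sum (fun a => - F a).
Proof.
move=> [f Ff]; exists (fun C b => - f C b) => a.
by rewrite Ff sumrN.
Qed.

(** The restriction of [a] to any [M] containing [A] determines [reset_outside o A a], so one
    maximal clique can carry the whole function and the others get zero. *)
Lemma clique_sum_clique (F : profile S -> R) (A : {set V}) :
  clique e A -> clique_sum (fun a => F (reset_outside o A a)).
Proof.
move=> /sub_maximal_clique[M Mmax AM].
exists (fun C b =>
  if C == M then F (reset_outside o A (extend_profile o b)) else 0) => a.
rewrite (bigD1 M) //= eqxx extend_restrict reset_outside_sub //.
by rewrite big1 ?addr0 // => C /andP[_ /negbTE ->].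
Qed.

Definition nonadjacent_additive (F : profile S -> R) : Prop :=
  forall i j : V, i != j -> ~~ e i j -> forall a : profile S,
    F a - F (reset o i a) = F (reset o j a) - F (reset o i (reset o j a)).

Lemma clique_sum_reset_outside (F : profile S -> R) (A : {set V}) :
  nonadjacent_additive F -> clique_sum (fun a => F (reset_outside o A a)).
Proof.
move=> Fadd; have [n] := ubnP #|A|; elim: n A => // n IHn A leAn.
have [/clique_sum_clique //|] := boolP (clique e A).
move=> /nonclique_nonadjacent[i [j [iA jA ij eij]]].
have smaller (B : {set V}) :
    B \proper A -> clique_sum (fun a => F (reset_outside o B a)).
  by move=> /proper_card ltBA; apply: IHn; apply: leq_trans ltBA _.
have Ai : A :\ i \proper A by apply: properD1.
have Aj : A :\ j \proper A by apply: properD1.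
have Aji : A :\ j :\ i \proper A.
  by apply: sub_proper_trans Aj; apply: subsetDl.
(* Inclusion-exclusion: the terms for [A :\ i] and [A :\ j] minus the one for [A :\ j :\ i] add up
   to the term for [A], by additivity at [reset_outside o A a]. *)
have [f Ff] := clique_sumD (smaller _ Ai)
  (clique_sumD (smaller _ Aj) (clique_sumN (smaller _ Aji))).
exists f => a; rewrite -Ff !reset_outsideD1.
by rewrite -(Fadd i j ij eij) addrC subrK.
Qed.

Definition incident_sum (PhiC : forall C : {set V}, subprofile S C -> R) :
    game R S :=
  fun i a =>
    \sum_(C in maximal_cliques e | i \in C) PhiC C (restrict_profile C a).

(** A clique through [i] cannot contain a non-adjacent [j], so resetting [j] changes no restriction
    in the sum. *)
Lemma graphical_incident_sum (PhiC : forall C : {set V}, subprofile S C -> R) :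
  graphical o e (incident_sum PhiC).
Proof.
move=> i j ij eij a; apply: eq_bigr => C /andP[].
rewrite inE => /maxsetp/forall_inP Ccl iC; rewrite restrict_reset //.
apply: contra eij => jC.
by move: (Ccl i iC) => /forall_inP/(_ j jC); rewrite ij.
Qed.

Lemma potential_incident_sum (PhiC : forall C : {set V}, subprofile S C -> R)
    (Phi : profile S -> R) :
  (forall a : profile S,
     Phi a = \sum_(C in maximal_cliques e) PhiC C (restrict_profile C a)) ->
  potential o (incident_sum PhiC) Phi.
Proof.
move=> PhiE i a; rewrite !PhiE.
rewrite !(bigID (fun C : {set V} => i \in C) (mem (maximal_cliques e))) /=.
(* Cliques that miss [i] do not see the reset of [i], so their terms cancel. *)
rewrite [X in _ = _ + X - _](eq_bigr
  (fun C => PhiC C (restrict_profile C (reset o i a)))).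
  by rewrite opprD addrACA subrr addr0.
by move=> C /andP[_ iC]; rewrite restrict_reset.
Qed.

(** Resetting [i] changes [u i] and [w i] by the same amount, that of [Phi]; so their difference can
    be evaluated with [o i] in place of the strategy of [i], and depends on the other players
    alone. *)
Lemma common_potential_equivalent (u w : game R S) (Phi : profile S -> R) :
  potential o u Phi -> potential o w Phi -> strategically_equivalent u w.
Proof.
move=> uPhi wPhi.
exists (fun i b => u i (extend_profile o b) - w i (extend_profile o b)) => i a.
rewrite extend_restrict reset_outsideC1.
apply/eqP; rewrite addrA addrAC -subr_eq.
by apply/eqP; rewrite uPhi -wPhi.
Qed.

Lemma equivalent_graphical_additive (u w : game R S) (Phi : profile S -> R) :
  potential o u Phi -> graphical o e w -> strategically_equivalent u w ->
  nonadjacent_additive Phi.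
Proof.
move=> uPhi wG [f uw] i j ij eij a.
(* The term [f i] takes the same value at [b] and at [reset o i b], so it drops out of the
   difference. *)
have wPhi b : Phi b - Phi (reset o i b) = w i b - w i (reset o i b).
  have iNi : i \notin ~: [set i] by rewrite !inE eqxx.
  by rewrite -uPhi !uw (restrict_reset _ _ iNi) opprD addrACA subrr addr0.
by rewrite !wPhi (wG i j ij eij a) (wG i j ij eij (reset o i a)) resetC.
Qed.

End CliqueSums.

Theorem theorem4p4 (R : realType) (V : finType) (S : V -> finType)
    (o : forall i : V, S i)
    (e : rel V) (e_sym : symmetric e) (e_irr : irreflexive e)
    (u : game R S) (Phi : profile S -> R)
    (Phi_potential : potential o u Phi) (Phi_normalized : normalized Phi) :
  (exists w : game R S, graphical o e w /\ strategically_equivalent u w)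
  <->
  (exists PhiC : forall C : {set V}, subprofile S C -> R,
     forall a : profile S,
       Phi a = \sum_(C in maximal_cliques e) PhiC C (restrict_profile C a)).
Proof.
split=> [[w [wG uw]]|[PhiC PhiE]].
  have Phi_add := equivalent_graphical_additive Phi_potential wG uw.
  have [f Phif] := clique_sum_reset_outside [set: V] Phi_add.
  by exists f => a; rewrite -Phif reset_outsideT.
exists (incident_sum e PhiC); split; first exact: graphical_incident_sum.
apply: (common_potential_equivalent Phi_potential).
exact: potential_incident_sum.
Qed.
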